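(* Let $\mathbb{X}$ be a real ordered vector space, $x,y\in\mathbb{X}$ with $x\le y$, let $\mathbb{Y}$ be an absolutely ordered space, and let $f:[x,y]\to\mathbb{Y}$ be a function of bounded variation. Then $f$ is constant if and only if $\mathcal{V}(f)=0$.
   Context: A real ordered vector space is a real vector space $\mathbb{X}$ with a cone $\mathbb{X}^+$ (non-empty, closed under addition and under multiplication by non-negative reals); $u\le v$ means $v-u\in\mathbb{X}^+$, and $u<v$ means $u\le v$ and $u\neq v$. For $x\le y$, $[x,y]=\{z\in\mathbb{X}: x\le z\le y\}$. A partition $\mathcal{P}$ of $[x,y]$ is a finite chain $x=x_0<x_1<\cdots<x_{n_{\mathcal P}}=y$ of points of $[x,y]$. An absolutely ordered space is a real ordered vector space $(\mathbb{Y},\mathbb{Y}^+)$ with a map $|\cdot|:\mathbb{Y}\to\mathbb{Y}^+$ such that: (a) $|u|=u$ for $u\in\mathbb{Y}^+$; (b) $|u|\pm u\in\mathbb{Y}^+$ for all $u$; (c) $|\alpha u|=|\alpha||u|$ for all $u\in\mathbb{Y},\alpha\in\mathbb{R}$; (d) if $|u-v|=u+v$ and $0\le w\le v$, then $|u-w|=u+w$; (e) if $|u-v|=u+v$ and $|u-w|=u+w$, then $\big|u-|v\pm w|\big|=u+|v\pm w|$. For $f:[x,y]\to\mathbb{Y}$ put $\Sigma_{\mathcal P}[f]=\sum_{i=1}^{n_{\mathcal P}}|f(x_i)-f(x_{i-1})|$. The function $f$ is of bounded variation if $\mathcal{V}(f)=\sup\{\Sigma_{\mathcal P}[f]:\mathcal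 P\text{ a partition of }[x,y]\}$ exists in $\mathbb{Y}$. *)

(* Defs.v *)
From HB Require Import structures.
From mathcomp Require Import all_boot all_order all_algebra.
From mathcomp Require Import boolp classical_sets reals.

Set Implicit Arguments.
Unset Strict Implicit.
Unset Printing Implicit Defensive.

Import Order.TTheory GRing.Theory Num.Theory.
Local Open Scope classical_set_scope.
Local Open Scope ring_scope.

(* The cone is not required to be proper, so the induced relation is only a
   preorder. *)
HB.mixin Record Lmodule_isOrderedVect (R : realType) V
    of GRing.Lmodule R V := {
  cone : set V ;
  cone_nonempty : cone !=set0 ;
  coneD : forall u v, cone u -> cone v -> cone (u + v) ;
  coneZ : forall (a : R) u, 0 <= a -> cone u -> cone (a *: u)
}.

#[short(type="orderedVectType")]
HB.structure Definition OrderedVect (R : realType) :=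
  {V of GRing.Lmodule R V & Lmodule_isOrderedVect R V}.

Section OrderedVectDefs.
Variables (R : realType) (V : orderedVectType R).
Implicit Types (u v : V) (A : set V).

Definition ole u v : Prop := cone (v - u).

(* Not [Order.lt], which on a preorder means [u <= v] and not [v <= u]. *)
Definition olt u v : Prop := ole u v /\ u <> v.

Definition oitv u v : set V := [set w | ole u w /\ ole w v].

Definition is_osup A s : Prop :=
  (forall u, A u -> ole u s) /\
  (forall t, (forall u, A u -> ole u t) -> ole s t).

End OrderedVectDefs.

HB.mixin Record OrderedVect_isAbsOrdered (R : realType) V
    of OrderedVect R V := {
  oabs : V -> V ;
  oabs_cone : forall u, cone (oabs u) ;
  oabs_id : forall u, cone u -> oabs u = u ;
  oabs_addsub : forall u, cone (oabs u + u) /\ cone (oabs u - u) ;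
  oabsZ : forall (a : R) u, oabs (a *: u) = `|a| *: oabs u ;
  oabs_orth_le : forall u v w, oabs (u - v) = u + v ->
    ole 0 w -> ole w v -> oabs (u - w) = u + w ;
  oabs_orth_add : forall u v w,
    oabs (u - v) = u + v -> oabs (u - w) = u + w ->
    oabs (u - oabs (v + w)) = u + oabs (v + w) /\
    oabs (u - oabs (v - w)) = u + oabs (v - w)
}.

#[short(type="absOrderedVectType")]
HB.structure Definition AbsOrderedVect (R : realType) :=
  {V of OrderedVect R V & OrderedVect_isAbsOrdered R V}.

(* A chain with a single point is allowed; it is the partition of [x, x].
   Only consecutive points are compared: as the cone may fail to be proper,
   [olt] need not be transitive. *)
Record opartition (R : realType) (X : orderedVectType R) (x y : X) :=
  OPartition {
    psize : nat ;
    ppoint : 'I_psize.+1 -> oitv x y ;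
    ppoint_first : \val (ppoint ord0) = x ;
    ppoint_last : \val (ppoint ord_max) = y ;
    ppoint_lt : forall i : 'I_psize,
      olt (\val (ppoint (widen_ord (leqnSn psize) i)))
          (\val (ppoint (lift ord0 i)))
  }.

Arguments ppoint {R X x y} P i : rename.

Section Variation.
Variables (R : realType) (X : orderedVectType R) (x y : X).
Variables (Y : absOrderedVectType R).
Implicit Types (f : oitv x y -> Y) (P : opartition x y).

Definition partition_sum f P : Y :=
  \sum_(i < psize P)
    oabs (f (ppoint P (lift ord0 i)) -
          f (ppoint P (widen_ord (leqnSn (psize P)) i))).

Definition bounded_variation_on f : Prop :=
  exists s, is_osup (range (partition_sum f)) s.

(* The supremum is unique, the cone of an absolutely ordered space being
   proper; the value is the dummy 0 if there is no supremum. *)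
Definition total_variation_on f : Y :=
  xget 0 [set s | is_osup (range (partition_sum f)) s].

End Variation.

(* Main.v *)
Require Import Defs.
From HB Require Import structures.
From mathcomp Require Import all_boot all_order all_algebra.
From mathcomp Require Import boolp classical_sets reals.

Set Implicit Arguments.
Unset Strict Implicit.
Unset Printing Implicit Defensive.

Import Order.TTheory GRing.Theory Num.Theory.
Local Open Scope classical_set_scope.
Local Open Scope ring_scope.

(** Write [V] for the total variation of [f].  If [f] is constant, every
    partition sum is [0]; as [[x, y]] has at least one partition, the set of
    partition sums is [{0}], whose only supremum is [0].

    Conversely, let [V = 0] and let [z] be a point of [[x, y]].  Inserting [z]
    between the endpoints, and omitting repeated points, gives a partition
    whose sum is [|f z - f x| + |f y - f z|] ([three_point_sum]).  So this sum
    is at most [0], hence so is its summand [|f z - f x|].  The cone of an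
    absolutely ordered space is proper ([cone_proper]) and [|u|] dominates
    both [u] and [-u], so [f z = f x].

    Suprema are unique for the same reason, which is what identifies [V] with
    the supremum provided by bounded variation.  The cone of the domain may be
    improper; only consecutive points of a chain are ever compared, so the
    chain [x, z, y] is legitimate even when [x = y <> z]. *)

Lemma cone0 (R : realType) (V : orderedVectType R) : cone (0 : V).
Proof.
have [u cu] := @cone_nonempty R V.
by rewrite -(scale0r u); apply: coneZ.
Qed.

Lemma ole_refl (R : realType) (V : orderedVectType R) (u : V) : ole u u.
Proof. by rewrite /ole subrr; exact: cone0. Qed.

Section AbsOrdered.
Variables (R : realType) (Y : absOrderedVectType R).
Implicit Types (u v : Y) (A : set Y).

Lemma oabs0 : oabs (0 : Y) = 0.
Proof. exact/oabs_id/cone0. Qed.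

Lemma oabsN u : oabs (- u) = oabs u.
Proof. by rewrite -scaleN1r oabsZ normrN1 scale1r. Qed.

(** On the cone the absolute value is the identity, and it is even; so if
    [u] and [- u] are both in the cone, [oabs u] is both [u] and [- u]. *)
Lemma cone_proper u : cone u -> cone (- u) -> u = 0.
Proof.
move=> cu cNu; have uN : u = - u by rewrite -[RHS]oabs_id // oabsN oabs_id.
have /eqP : 2%:R *: u = 0 by rewrite scaler_nat mulr2n {2}uN subrr.
by rewrite scaler_eq0 pnatr_eq0 => /eqP.
Qed.

Lemma ole_anti u v : ole u v -> ole v u -> u = v.
Proof.
move=> uv vu; apply/esym/subr0_eq/cone_proper => //.
by rewrite opprB.
Qed.

Lemma oabs_eq0 u : oabs u = 0 -> u = 0.
Proof.
move=> u0; have [] := oabs_addsub u; rewrite u0 add0r sub0r.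
exact: cone_proper.
Qed.

Lemma oabs_add_le0 u v : ole (oabs u + oabs v) 0 -> u = 0.
Proof.
rewrite /ole sub0r => uv_le0; apply/oabs_eq0/cone_proper; first exact: oabs_cone.
have -> : - oabs u = - (oabs u + oabs v) + oabs v.
  by rewrite opprD addrNK.
by apply: coneD => //; exact: oabs_cone.
Qed.

Lemma is_osup_unique A u v : is_osup A u -> is_osup A v -> u = v.
Proof.
by move=> [uA uP] [vA vP]; apply: ole_anti; [exact: uP | exact: vP].
Qed.

Lemma is_osup_set1 u : is_osup [set u] u.
Proof. by split=> [v ->|t]; [exact: ole_refl | apply]. Qed.

End AbsOrdered.

Section Variation.
Variables (R : realType) (X : orderedVectType R) (x y : X).
Variables (Y : absOrderedVectType R).
Implicit Types (f : oitv x y -> Y).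

Lemma total_variationP f :
  bounded_variation_on f ->
  is_osup (range (partition_sum f)) (total_variation_on f).
Proof. exact: xgetPex. Qed.

(** Lists are a convenient way to present a partition, whose length is hidden
    in the dependent type of its points.  The first point [a] is kept apart
    from the list [s] of the others, as its own value serves as the default of
    [nth]. *)
Lemma list_partition f (a : oitv x y) (s : seq (oitv x y)) :
  \val a = x -> \val (last a s) = y ->
  (forall i, (i < size s)%N ->
     olt (\val (nth a (a :: s) i)) (\val (nth a s i))) ->
  exists P : opartition x y,
    partition_sum f P =
    \sum_(i < size s) oabs (f (nth a s i) - f (nth a (a :: s) i)).
Proof.
move=> ax sy lt_s.
pose p (i : 'I_(size s).+1) := nth a (a :: s) i.
have p_last : \val (p ord_max) = y by rewrite /p -last_nth.
have p_lt (i : 'I_(size s)) :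
    olt (\val (p (widen_ord (leqnSn (size s)) i))) (\val (p (lift ord0 i))).
  exact: (lt_s i (ltn_ord i)).
by exists (@OPartition R X x y (size s) p ax p_last p_lt).
Qed.

(** The terms of the repeated points vanish, so the formula covers the
    degenerate positions of [z] uniformly. *)
Lemma three_point_sum f (a z b : oitv x y) :
  \val a = x -> ole x y -> \val b = y ->
  exists P : opartition x y,
    partition_sum f P = oabs (f z - f a) + oabs (f b - f z).
Proof.
move=> ax xy bY.
have [xz zy] : oitv x y (\val z) := set_mem (valP z).
have [za|/eqP za] := eqVneq z a; have [zb|/eqP zb] := eqVneq z b.
- have [//|||P PE] := @list_partition f a [::]; rewrite //= -?za ?zb //.
  by exists P; rewrite PE big_ord0 -zb za subrr oabs0 addr0.
- have [//|//|[]//= _|P PE] := @list_partition f a [:: b].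
    by split; [rewrite ax bY | move=> /val_inj ab; apply: zb; rewrite za].
  by exists P; rewrite PE big_ord1 za subrr oabs0 add0r.
- have [//|//|[]//= _|P PE] := @list_partition f a [:: b].
    by split; [rewrite ax bY | move=> /val_inj ab; apply: za; rewrite zb].
  by exists P; rewrite PE big_ord1 zb subrr oabs0 addr0.
- have [//|//|[|[|?]]//= _|P PE] := @list_partition f a [:: z; b].
  + by split; [rewrite ax | move=> /val_inj az; apply: za].
  + by split; [rewrite bY | move=> /val_inj].
  by exists P; rewrite PE big_ord_recl big_ord1.
Qed.

End Variation.

Theorem lemma3p8 (R : realType) (X : orderedVectType R) (x y : X)
    (hxy : ole x y) (Y : absOrderedVectType R) (f : oitv x y -> Y)
    (hf : bounded_variation_on f) :
  (exists c : Y, forall z : oitv x y, f z = c) <-> total_variation_on f = 0.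
Proof.
have xI : x \in oitv x y by apply/mem_set; split; first exact: ole_refl.
have yI : y \in oitv x y by apply/mem_set; split; last exact: ole_refl.
pose a : oitv x y := SigSub xI; pose b : oitv x y := SigSub yI.
have supV := total_variationP hf.
split=> [[c fc]|V0].
- apply: (is_osup_unique supV).
  have sum0 P : partition_sum f P = 0.
    by apply: big1 => i _; rewrite !fc subrr oabs0.
  suff -> : range (partition_sum f) = [set 0] by exact: is_osup_set1.
  apply/seteqP; split=> [_ [P _ <-] //=|_ ->].
  have [//|//|//|P _] := @three_point_sum R X x y Y f a a b.
  by exists P.
- exists (f a) => z; apply/subr0_eq.
  have [//|//|//|P PE] := @three_point_sum R X x y Y f a z b.
  apply: (@oabs_add_le0 _ _ _ (f b - f z)); rewrite -PE -V0.
  by apply: supV.1; exists P.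
Qed.
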